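(* Let $\Phi:[0,\ell(I)[\,\to\mathbb{R}_+$ be an error function and let $f:I\to\mathbb{R}$ be $\Phi$-Hölder. Assume that both functions are locally Lebesgue integrable. Then, for every $x<y$ in $I$, $$\bigg|f(p)-\frac{1}{y-x}\int_x^y f\bigg|\le\frac{1}{y-x}\bigg(\int_0^{p-x}\Phi+\int_0^{y-p}\Phi\bigg)\qquad(p\in[x,y]).$$ Furthermore, if $\Phi$ is subadditive and nondecreasing with $\Phi(0)=0$, then, for all $x<y$ in $I$, $$\sup_{f}\bigg|f(p)-\frac{1}{y-x}\int_x^y f\bigg|=\frac{1}{y-x}\bigg(\int_0^{p-x}\Phi+\int_0^{y-p}\Phi\bigg)\qquad(p\in[x,y]),$$ where the supremum is taken over all locally Lebesgue integrable $\Phi$-Hölder functions $f:I\to\mathbb{R}$.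
   Context: $I$ is a nonempty open real interval and $\ell(I)\in\,]0,\infty]$ is its length; $\mathbb{R}_+=[0,\infty[$. An error function is any function $\Phi:[0,\ell(I)[\,\to\mathbb{R}_+$; it is subadditive if $\Phi(u+v)\le\Phi(u)+\Phi(v)$ for all $u,v\in\mathbb{R}_+$ with $u+v<\ell(I)$. A function on an interval is locally Lebesgue integrable if it has a finite Lebesgue integral over every compact subinterval of its domain. $f:I\to\mathbb{R}$ is $\Phi$-Hölder if $|f(x)-f(y)|\le\Phi(|x-y|)$ for all $x,y\in I$. *)

(* Defs.v *)
From HB Require Import structures.
From mathcomp Require Import all_boot all_order all_algebra.
From mathcomp Require Import all_classical all_reals all_analysis.

Set Implicit Arguments.
Unset Strict Implicit.
Unset Printing Implicit Defensive.

Import Order.TTheory GRing.Theory Num.Theory.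
Import numFieldNormedType.Exports.

Local Open Scope classical_set_scope.
Local Open Scope ring_scope.

Definition open_interval (R : realType) (I : set R) : Prop :=
  [/\ is_interval I, open I & I !=set0].

Definition ilength (R : realType) (I : set R) : \bar R :=
  (ereal_sup (EFin @` I) - ereal_inf (EFin @` I))%E.

(* The interval [0, l(I)[.  Functions on I or on [0, l(I)[ are represented by
   total functions R -> R, of which only the values on the domain are used. *)
Definition error_domain (R : realType) (I : set R) : set R :=
  [set u : R | 0 <= u /\ (u%:E < ilength I)%E].

Definition error_function (R : realType) (I : set R) (Phi : R -> R) : Prop :=
  forall u, error_domain I u -> 0 <= Phi u.

Definition error_subadditive (R : realType) (I : set R) (Phi : R -> R) : Prop :=
  forall u v, 0 <= u -> 0 <= v -> ((u + v)%:E < ilength I)%E ->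
    Phi (u + v) <= Phi u + Phi v.

Definition error_nondecreasing (R : realType) (I : set R) (Phi : R -> R) : Prop :=
  forall u v, error_domain I u -> error_domain I v -> u <= v -> Phi u <= Phi v.

Definition holder_on (R : realType) (I : set R) (Phi f : R -> R) : Prop :=
  forall x y, I x -> I y -> `|f x - f y| <= Phi `|x - y|.

(* The completed measure is used so that measurability means Lebesgue
   measurability, whereas lebesgue_measure is defined on Borel sets only. *)
Definition locally_lebesgue_integrable (R : realType) (D : set R) (f : R -> R)
    : Prop :=
  forall a b : R, a <= b -> `[a, b] `<=` D ->
    (@completed_lebesgue_measure R).-integrable `[a, b] (EFin \o f).

Definition lebesgue_int (R : realType) (a b : R) (f : R -> R) : R :=
  Rintegral (@completed_lebesgue_measure R) `[a, b] f.

(* Main.v *)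
(* Since y - x is the length of [x, y], the left-hand side is the absolute value
   of the mean over t in [x, y] of f p - f t, hence at most the mean of
   Phi |p - t|.  Splitting [x, y] at p and changing variables gives the bound.
   If Phi is subadditive and nondecreasing, t |-> Phi |p - t| is itself
   Phi-Hoelder; it vanishes at p when Phi 0 = 0, so it attains the bound.
   The changes of variables only use reflections t |-> c - t: they map covers by
   open intervals to covers of the same total length, so they preserve the
   Lebesgue outer measure and with it the completed Lebesgue measure. *)
Require Import Defs.
From HB Require Import structures.
From mathcomp Require Import all_boot all_order all_algebra.
From mathcomp Require Import all_classical all_reals all_analysis.
From mathcomp Require Import measurable_realfun ring lra.

Set Implicit Arguments.
Unset Strict Implicit.
Unset Printing Implicit Defensive.

Import Order.TTheory GRing.Theory Num.Theory.
Import numFieldNormedType.Exports.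

Local Open Scope classical_set_scope.
Local Open Scope ring_scope.

Local Notation lambda := completed_lebesgue_measure.
Local Notation outer := (mu_ext (wlength idfun)).
(** [lambda] lives on the Caratheodory sigma-algebra of [outer], not on the Borel one that [R]
    carries by default, so measurable sets and the carrier type are named explicitly. *)
Local Notation Lebesgue_measurable A := ((outer).-cara.-measurable A).
Local Notation LR := (caratheodory_type (mu_ext (wlength idfun))).

(** * Invariance of the completed Lebesgue measure under reflections *)

Section reflection.
Context {R : realType}.
Implicit Types (A D : set R) (a b c t : R).

(** The point reflection about [c / 2]. *)
Definition refl c t : R := c - t.

Lemma reflK c : involutive (refl c).
Proof. by move=> t; rewrite /refl opprB addrC subrK. Qed.

Lemma refl_preimageK c A : refl c @^-1` (refl c @^-1` A) = A.
Proof. by apply/seteqP; split => t /=; rewrite reflK. Qed.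

(** A reflection reverses the order, so a bound just before [a] becomes one just after [c - a];
    negating the side flags treats open and closed ends at once. *)
Lemma refl_preimage_itv c a b (x y : bool) :
  refl c @^-1` [set` Interval (BSide x a) (BSide y b)] =
  [set` Interval (BSide (~~ y) (c - b)) (BSide (~~ x) (c - a))].
Proof.
by apply/seteqP; split => t /=; rewrite /refl !itv_boundlr /= /Order.le /=;
  case: x; case: y => /= /andP[? ?]; apply/andP; split; lra.
Qed.

Lemma outer_measure_refl_le c A :
  (outer (refl c @^-1` A) <= outer A :> \bar R)%E.
Proof.
rewrite !outer_measure_open_itv_cover.
apply: le_ereal_inf_tmp => _ [F [Fitv AF] <-].
apply: ereal_inf_lbound; exists (fun k => refl c @^-1` F k).
  split=> [k|t /AF[k _ Fk]]; last by exists k.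
  by have [[a b] /= ->] := Fitv k; exists (c - b, c - a);
    rewrite refl_preimage_itv.
apply: eq_eseriesr => k _; have [[a b] /= ->] := Fitv k.
rewrite refl_preimage_itv !wlength_itv /= !lte_fin ltrD2l ltrN2.
by rewrite -!EFinB; congr (if _ then _%:E else _); lra.
Qed.

(** Since [refl c] is an involution, the previous inequality applied to the reflected set gives the
    reverse one. *)
Lemma outer_measure_refl c A : outer (refl c @^-1` A) = outer A :> \bar R.
Proof.
apply/eqP; rewrite eq_le outer_measure_refl_le /=.
by rewrite -{1}(refl_preimageK c A) outer_measure_refl_le.
Qed.

(** Testing the Caratheodory criterion for the reflected set on [X] amounts to testing it for [A] on
    the reflection of [X], by invariance of [outer]. *)
Lemma measurable_refl_preimage c A :
  Lebesgue_measurable A -> Lebesgue_measurable (refl c @^-1` A).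
Proof.
move=> mA; change (caratheodory_measurable outer (refl c @^-1` A)) => X.
rewrite -(refl_preimageK c X).
rewrite (_ : ~` (refl c @^-1` A) = refl c @^-1` (~` A)) // -!preimage_setI.
by rewrite !outer_measure_refl -(outer_measure_refl c X); exact: mA.
Qed.

Lemma measurable_refl c : measurable_fun setT (refl c : LR -> LR).
Proof. by move=> _ A mA; rewrite setTI; exact: measurable_refl_preimage. Qed.

Lemma Lebesgue_measurable_itv (i : interval R) : Lebesgue_measurable [set` i].
Proof. by apply: sub_caratheodory; exact: (@measurable_itv R i). Qed.

(** The pushforward of [lambda] along [refl c] is [lambda] itself, so this is the change of
    variables for a pushforward measure. *)
Lemma ge0_integral_refl c D (f : LR -> \bar R) :
  Lebesgue_measurable D -> measurable_fun (D : set LR) f ->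
  (forall t, D t -> 0 <= f t)%E ->
  (\int[lambda]_(t in D) f t =
   \int[lambda]_(t in refl c @^-1` D) f (refl c t))%E.
Proof.
move=> mD mf f0.
rewrite -(ge0_integral_pushforward (measurable_refl c))//=; last first.
  by move=> t /[!inE]; exact: f0.
apply: eq_measure_integral => [|? A mA _]; first exact: measurable_refl.
exact/esym/outer_measure_refl.
Qed.

(** For a function of any sign, finiteness follows from the nonnegative case applied to its absolute
    value. *)
Lemma integrable_refl c D (f : R -> R) : Lebesgue_measurable D ->
  lambda.-integrable D (EFin \o f) ->
  lambda.-integrable (refl c @^-1` D) (EFin \o (f \o refl c)).
Proof.
move=> mD /integrableP[mf foo]; apply/integrableP; split.
  apply: (measurable_comp mD _ mf) => [_ [t Dt <-]//|].
  exact: measurable_funS (measurable_refl c).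
rewrite -(ge0_integral_refl c (f := fun t => `|(f t)%:E|)%E)//.
exact: measurableT_comp.
Qed.

Lemma lebesgue_int_refl c a b (f : R -> R) :
  lambda.-integrable `[a, b] (EFin \o f) ->
  (forall t, a <= t <= b -> 0 <= f t) ->
  lebesgue_int a b f = lebesgue_int (c - b) (c - a) (f \o refl c).
Proof.
move=> intf f0; rewrite /lebesgue_int /Rintegral.
rewrite (ge0_integral_refl c); first by rewrite refl_preimage_itv.
- exact: Lebesgue_measurable_itv.
- exact: measurable_int intf.
- by move=> t /=; rewrite in_itv /= lee_fin => /f0.
Qed.
End reflection.

(** * Integrals over adjacent intervals and integrals of constants *)

Lemma integrableU d (T : measurableType d) (R : realType)
    (mu : {measure set T -> \bar R}) (A B : set T) (f : T -> \bar R) :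
  measurable A -> measurable B -> [disjoint A & B] ->
  mu.-integrable A f -> mu.-integrable B f -> mu.-integrable (A `|` B) f.
Proof.
move=> mA mB AB /integrableP[mfA fA] /integrableP[mfB fB].
have mf : measurable_fun (A `|` B) f by apply/measurable_funU.
apply/integrableP; split=> //; rewrite ge0_integral_setU//.
  exact: lte_add_pinfty.
exact: measurableT_comp.
Qed.

Section interval_integrals.
Context {R : realType}.
Implicit Types (a b c p t : R) (f : R -> R).

(** The right piece is open at [p], so that additivity over disjoint sets applies when [[a, b]] is
    cut at [p]. *)
Lemma disjoint_itv_cc_oc a b p : [disjoint `[a, p] & `]p, b] : set R].
Proof.
apply/disj_setPS => t /= [] /=; rewrite !in_itv /= => /andP[_ tp] /andP[pt _].
by move: (le_lt_trans tp pt); rewrite ltxx.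
Qed.

Lemma itv_cc_split a b p :
  a <= p -> p <= b -> `[a, b]%classic = `[a, p] `|` `]p, b] :> set R.
Proof. by move=> ap pb; apply: itv_bndbnd_setU; rewrite bnd_simp. Qed.

(** The Borel measure and its completion are computed by the same outer measure, so the length
    formula transfers by conversion. *)
Lemma completed_lebesgue_measure_itv (i : interval R) :
  ((lambda : {measure set LR -> \bar R}) [set` i] =
   if i.1 < i.2 then i.2%E - i.1%E else 0)%E.
Proof. exact: (lebesgue_measure_itv i). Qed.

Lemma integrable_itv_cat a b p f : a <= p -> p <= b ->
  lambda.-integrable `[a, p] (EFin \o f) ->
  lambda.-integrable `[p, b] (EFin \o f) ->
  lambda.-integrable `[a, b] (EFin \o f).
Proof.
move=> ap pb fap fpb; rewrite (itv_cc_split ap pb); apply: integrableU => //.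
- exact: Lebesgue_measurable_itv.
- exact: Lebesgue_measurable_itv.
- exact: disjoint_itv_cc_oc.
- apply: integrableS fpb; [exact: Lebesgue_measurable_itv..|].
  exact: subset_itv_oc_cc.
Qed.

Lemma lebesgue_int_cat a b p f : a <= p -> p <= b ->
  lambda.-integrable `[a, b] (EFin \o f) ->
  lebesgue_int a b f = lebesgue_int a p f + lebesgue_int p b f.
Proof.
move=> ap pb fab.
have sub c d : a <= c -> d <= b -> lambda.-integrable `[c, d] (EFin \o f).
  move=> ac db; apply: integrableS fab; [exact: Lebesgue_measurable_itv..|].
  by apply: subset_itv; rewrite bnd_simp.
have null : \int[lambda]_(t in `[p, p]) f t = 0.
  rewrite /Rintegral null_set_integral//.
  - exact: Lebesgue_measurable_itv.
  - exact: measurable_int (sub p p ap pb).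
  - by rewrite completed_lebesgue_measure_itv /= ltxx.
have split c : a <= c -> c <= p ->
    lebesgue_int c b f = lebesgue_int c p f + \int[lambda]_(t in `]p, b]) f t.
  move=> ac cp; rewrite /lebesgue_int (itv_cc_split cp pb) Rintegral_setU//.
  - exact: Lebesgue_measurable_itv.
  - exact: Lebesgue_measurable_itv.
  - by rewrite -(itv_cc_split cp pb); exact: sub.
  - exact: disjoint_itv_cc_oc.
(* Taking [c = p] in [split] identifies the integral over [[p, b]] with that over []p, b]], because
   [[p, p]] is a null set. *)
by rewrite split// (split p)// [X in _ + (X + _)]null add0r.
Qed.

Lemma integrable_itv_cst a b (k : R) :
  lambda.-integrable `[a, b] (EFin \o cst k).
Proof.
apply/integrableP; split; first exact: (measurable_cst k%:E).
rewrite (integral_cst _ _ `|k|%:E)%E; last exact: Lebesgue_measurable_itv.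
rewrite completed_lebesgue_measure_itv /= lte_fin.
by case: ifP => _; rewrite ?mule0 -?EFinB -?EFinM ltry.
Qed.

Lemma lebesgue_int_cst a b (k : R) : a <= b ->
  lebesgue_int a b (cst k) = (b - a) * k.
Proof.
move=> ab; rewrite /lebesgue_int Rintegral_cst; last first.
  exact: Lebesgue_measurable_itv.
rewrite completed_lebesgue_measure_itv /= lte_fin mulrC.
case: ltP => // ba; suff -> : b = a by rewrite subrr.
by apply/eqP; rewrite eq_le ba ab.
Qed.

End interval_integrals.

(** * The distance functions [Phi |p - t|] and the deviation from the mean *)

Section holder.
Context {R : realType}.
Variables (I : set R) (Phi : R -> R).
Hypothesis hI : open_interval I.
Hypothesis hPhi : error_function I Phi.
Hypothesis iPhi : locally_lebesgue_integrable (error_domain I) Phi.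
Implicit Types (a b p t x y : R) (f : R -> R).

(** The strict bound comes from openness: [I] contains some [b' > b], and
    [b - a < b' - a <= ilength I]. *)
Lemma error_domain_sub a b : I a -> I b -> a <= b -> error_domain I (b - a).
Proof.
case: hI => _ oI _ Ia Ib ab; split; first by rewrite subr_ge0.
have [b' bb' Ib'] : exists2 b', b < b' & I b'.
  have /nbhs_ballP[e /= e0 be] : nbhs b I by move: oI => /(_ b); exact.
  exists (b + e / 2); first by rewrite ltrDl divr_gt0.
  by apply: be; rewrite /ball /= opprD addrA subrr sub0r normrN gtr0_norm;
    [rewrite ltr_pdivrMr// ltr_pMr// ltr1n|rewrite divr_gt0].
apply: (@lt_le_trans _ _ (b' - a)%:E); first by rewrite lte_fin ltrD2r.
by rewrite /ilength EFinB leeB//; [apply: ereal_sup_ubound; exists b'|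
  apply: ereal_inf_lbound; exists a].
Qed.

Lemma error_domain_dist a b : I a -> I b -> error_domain I `|a - b|.
Proof.
move=> Ia Ib; have [ab|/ltW ba] := leP a b.
  by rewrite distrC ger0_norm ?subr_ge0//; exact: error_domain_sub.
by rewrite ger0_norm ?subr_ge0//; exact: error_domain_sub.
Qed.

Lemma error_domain_itv d : error_domain I d -> `[0, d] `<=` error_domain I.
Proof.
move=> [d0 dI] u /=; rewrite in_itv /= => /andP[u0 ud]; split=> //.
by apply: le_lt_trans dI; rewrite lee_fin.
Qed.

Lemma integrable_error d : error_domain I d ->
  lambda.-integrable `[0, d] (EFin \o Phi).
Proof. by move=> Id; apply: iPhi; [case: Id|exact: error_domain_itv]. Qed.

(** To the left of [p] the absolute value drops, and the integrand is [Phi] composed with [refl p],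
    which exchanges [[x, p]] and [[0, p - x]]. *)
Lemma error_left x p : I x -> I p -> x <= p ->
  lambda.-integrable `[x, p] (EFin \o (fun t => Phi `|p - t|)) /\
  lebesgue_int x p (fun t => Phi `|p - t|) = lebesgue_int 0 (p - x) Phi.
Proof.
move=> Ix Ip xp; have dom := error_domain_sub Ix Ip xp.
have iP := integrable_error dom.
have E : {in `[x, p]%classic, (fun t => Phi `|p - t|) =1 Phi \o refl p}.
  by move=> t /[!inE] /=; rewrite in_itv /= => /andP[_ tp];
    rewrite ger0_norm ?subr_ge0.
split.
- apply: (eq_integrable (Lebesgue_measurable_itv _) (EFin \o (Phi \o refl p))).
  + by move=> t tI; rewrite /= -[_ (refl p t)]/((Phi \o refl p) t) -E.
  + have := integrable_refl p (Lebesgue_measurable_itv `[0, p - x]) iP.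
    by rewrite refl_preimage_itv /= subKr subr0.
- rewrite [RHS](lebesgue_int_refl p)// ?subKr ?subr0.
    exact: eq_Rintegral.
  by move=> t t0; apply/hPhi/(error_domain_itv dom); rewrite /= in_itv.
Qed.

(* A translation is the composite of two reflections. *)
Lemma error_right p y : I p -> I y -> p <= y ->
  lambda.-integrable `[p, y] (EFin \o (fun t => Phi `|p - t|)) /\
  lebesgue_int p y (fun t => Phi `|p - t|) = lebesgue_int 0 (y - p) Phi.
Proof.
move=> Ip Iy py; have [iL eL] := error_left Ip Iy py.
(* [refl (p + y)] swaps [p] and [y], so it turns the distance to [y] into the distance to [p]. *)
have E : (fun t => Phi `|y - t|) \o refl (p + y) = fun t => Phi `|p - t|.
  by apply/funext => t /=; rewrite distrC /refl; congr (Phi `|_|); ring.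
split.
- have := integrable_refl (p + y) (Lebesgue_measurable_itv `[p, y]) iL.
  by rewrite refl_preimage_itv /= addrK addrAC subrr add0r E.
- rewrite -eL (lebesgue_int_refl (p + y) iL).
    by rewrite addrK addrAC subrr add0r E.
  move=> t /andP[pt ty]; apply/hPhi/error_domain_dist => //.
  by case: hI => iI _ _; apply: (iI p y) => //; rewrite pt.
Qed.

(** Here [p] may lie outside [[a, b]]. The interval is enlarged until it contains [p], cut there,
    and restricted again. *)
Lemma integrable_error_dist a b p : I a -> I b -> I p -> a <= b ->
  lambda.-integrable `[a, b] (EFin \o (fun t => Phi `|p - t|)).
Proof.
move=> Ia Ib Ip ab.
have Imin : I (Num.min a p) by rewrite minEle; case: ifP.
have Imax : I (Num.max b p) by rewrite maxEle; case: ifP.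
have int : lambda.-integrable `[Num.min a p, Num.max b p]
    (EFin \o (fun t => Phi `|p - t|)).
  apply: (@integrable_itv_cat _ _ _ p); rewrite ?ge_min ?le_max ?lexx ?orbT//.
    by have [] := error_left Imin Ip; rewrite ?ge_min ?lexx ?orbT.
  by have [] := error_right Ip Imax; rewrite ?le_max ?lexx ?orbT.
apply: integrableS int; [exact: Lebesgue_measurable_itv..|].
by apply: subset_itv; rewrite bnd_simp ?ge_min ?le_max lexx.
Qed.

Lemma lebesgue_int_error_dist x y p : I x -> I y -> x <= p <= y ->
  lebesgue_int x y (fun t => Phi `|p - t|) =
  lebesgue_int 0 (p - x) Phi + lebesgue_int 0 (y - p) Phi.
Proof.
move=> Ix Iy /andP[xp py].
have Ip : I p by case: hI => iI _ _; apply: (iI x y) => //; rewrite xp.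
rewrite (lebesgue_int_cat xp py); last first.
  by apply: integrable_error_dist => //; exact: le_trans py.
by rewrite (error_left Ix Ip xp).2 (error_right Ip Iy py).2.
Qed.

Lemma holder_average_le f : holder_on I Phi f ->
  locally_lebesgue_integrable I f ->
  forall x y p, I x -> I y -> x < y -> x <= p <= y ->
  `|f p - (y - x)^-1 * lebesgue_int x y f| <=
  (y - x)^-1 * (lebesgue_int 0 (p - x) Phi + lebesgue_int 0 (y - p) Phi).
Proof.
move=> hf lf x y p Ix Iy xy xpy.
have iI : is_interval I by case: hI.
have Ip : I p by apply: (iI x y).
have Ixy : `[x, y] `<=` I by move=> t; rewrite /= in_itv /=; exact: iI.
have intf : lambda.-integrable `[x, y] (EFin \o f).
  by apply: lf => //; exact: ltW.
have mxy := Lebesgue_measurable_itv `[x, y].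
have intd : lambda.-integrable `[x, y] (EFin \o (fun t => f p - f t)).
  exact: (integrableB mxy (integrable_itv_cst x y (f p)) intf).
have yx0 : 0 < y - x by rewrite subr_gt0.
rewrite -lebesgue_int_error_dist//.
have intB : lebesgue_int x y (fun t => f p - f t) =
    (y - x) * f p - lebesgue_int x y f.
  rewrite -(lebesgue_int_cst _ (ltW xy)).
  exact: (RintegralB mxy (integrable_itv_cst x y (f p)) intf).
(* The constant [f p] equals its own mean, so the deviation is a single mean, to which the pointwise
   Hölder bound applies. *)
have -> : f p - (y - x)^-1 * lebesgue_int x y f =
    (y - x)^-1 * lebesgue_int x y (fun t => f p - f t).
  by rewrite intB mulrBr mulKf// gt_eqF.
rewrite normrM gtr0_norm ?invr_gt0// ler_pM2l ?invr_gt0//.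
apply: (le_trans (le_normr_Rintegral mxy intd)).
apply: le_Rintegral.
- exact: Lebesgue_measurable_itv.
- exact: integrable_norm.
- by apply: integrable_error_dist => //; exact: ltW.
- by move=> t /Ixy It; exact: hf.
Qed.

Lemma error_dist_holder p : error_subadditive I Phi ->
  error_nondecreasing I Phi -> I p ->
  holder_on I Phi (fun t => Phi `|p - t|).
Proof.
move=> sP nP Ip.
(* This one-sided inequality is enough: exchanging [s] and [t] gives the other half of the absolute
   value bound. *)
suff le s t : I s -> I t -> Phi `|p - s| <= Phi `|p - t| + Phi `|s - t|.
  move=> s t Is It; rewrite ler_norml lerBlDl le// andbT.
  by rewrite lerBrDl lerBlDr (distrC s) le.
(* If [s] is closer to [p] than [t], monotonicity and [Phi >= 0] suffice. Otherwise [|p - s|] is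
   written as [|p - t|] plus a remainder of size at most [|s - t|]; subadditivity separates the two
   terms and monotonicity bounds the second. *)
move=> Is It; have [ts|/ltW st] := leP `|p - t| `|p - s|; last first.
  apply: (le_trans (nP _ _ _ _ st)); [exact: error_domain_dist..|].
  by rewrite lerDl; apply/hPhi/error_domain_dist.
have tri : `|p - s| - `|p - t| <= `|s - t|.
  by rewrite lerBlDl (distrC s) ler_distD.
have [_ dI] := error_domain_dist Ip Is.
(* Monotonicity holds only on the error domain; the remainder lies there because it is between 0 and
   [|p - s|]. *)
have uI : error_domain I (`|p - s| - `|p - t|).
  apply: (error_domain_itv (error_domain_dist Ip Is)).
  by rewrite /= in_itv /= subr_ge0 ts lerBlDl lerDr normr_ge0.
rewrite -{1}[`|p - s|](subrKC `|p - t|).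
apply: (le_trans (sP _ _ _ _ _)); rewrite ?subr_ge0 ?subrKC//.
by rewrite lerD2l; apply: nP => //; exact: error_domain_dist.
Qed.

End holder.

Theorem theorem6p1 (R : realType) (I : set R) (Phi : R -> R)
    (hI : open_interval I)
    (hPhi : error_function I Phi)
    (iPhi : locally_lebesgue_integrable (error_domain I) Phi) :
  (forall f : R -> R,
     holder_on I Phi f -> locally_lebesgue_integrable I f ->
     forall x y p : R, I x -> I y -> x < y -> x <= p <= y ->
       `|f p - (y - x)^-1 * lebesgue_int x y f|
         <= (y - x)^-1 *
            (lebesgue_int 0 (p - x) Phi + lebesgue_int 0 (y - p) Phi))
  /\
  (error_subadditive I Phi -> error_nondecreasing I Phi -> Phi 0 = 0 ->
     forall x y p : R, I x -> I y -> x < y -> x <= p <= y ->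
       ereal_sup [set (`|f p - (y - x)^-1 * lebesgue_int x y f|)%:E |
                    f in [set f : R -> R |
                            locally_lebesgue_integrable I f /\
                            holder_on I Phi f]]
       = ((y - x)^-1 *
          (lebesgue_int 0 (p - x) Phi + lebesgue_int 0 (y - p) Phi))%:E).
Proof.
split=> [f hf lf|sP nP P0 x y p Ix Iy xy xpy].
  exact: (holder_average_le hI hPhi iPhi).
have iI : is_interval I by case: hI.
have Ip : I p by apply: (iI x y).
apply/eqP; rewrite eq_le; apply/andP; split.
  apply: ge_ereal_sup => _ [f [lf hf] <-]; rewrite lee_fin.
  exact: (holder_average_le hI hPhi iPhi).
apply: ereal_sup_ubound; exists (fun t => Phi `|p - t|).
  split; last exact: error_dist_holder.
  move=> a b ab abI.
  by apply: (integrable_error_dist hI hPhi iPhi) => //; apply: abI;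
    rewrite /= in_itv /= ab lexx.
rewrite (lebesgue_int_error_dist hI hPhi iPhi)//.
(* The witness vanishes at [p] because [Phi 0 = 0], so its deviation is its mean up to sign; the
   mean is nonnegative since [Phi] is. *)
rewrite subrr normr0 P0 sub0r normrN ger0_norm//.
rewrite mulr_ge0 ?invr_ge0 ?subr_ge0 ?(ltW xy)//.
rewrite -(lebesgue_int_error_dist hI hPhi iPhi)//.
apply: Rintegral_ge0 => t; rewrite /= in_itv /= => txy.
by apply/hPhi/error_domain_dist => //; exact: (iI x y).
Qed.
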